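(* Let $\mathcal{B}=\{u_1,\dots,u_N\}$ be an orthonormal basis of $\mathbb{K}^N$, with associated unitary matrix $U$, let $X\neq\{0\}$ be a Banach space over $\mathbb{K}$, and let $p\in[1,\infty]$ with conjugate exponent $p'$. Then for every $f\in X^N$, $$\|\hat f\|_\infty\le\kappa_{p'}(U)\,\|f\|_p,\qquad \|f\|_\infty\le\kappa_{p'}(U^* )\,\|\hat f\|_p .$$ In particular, for every $f\in X^N$, $$\|\hat f\|_\infty\le\|U\|_\infty\|f\|_1,\quad \|f\|_\infty\le\|U\|_\infty\|\hat f\|_1,\quad \|\hat f\|_\infty\le\|f\|_2,\quad \|f\|_\infty\le\|\hat f\|_2 .$$ Consequently, $\mathcal{F}:L^p(V,X)\to L^\infty(V,X)$ is a topological isomorphism, and its operator norm is $$\|\mathcal{F}\|_{p\to\infty}=\kappa_{p'}(U).$$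
   Context: $\mathbb{K}$ is $\mathbb{R}$ or $\mathbb{C}$, $N\ge 1$, $V=\{1,\dots,N\}$. An $X$-valued signal is a function $f:V\to X$, identified with $(f(1),\dots,f(N))\in X^N$. Norms: $\|f\|_p=\left(\sum_{n=1}^N\|f(n)\|^p\right)^{1/p}$ for $p\in[1,\infty)$ and $\|f\|_\infty=\max_{1\le n\le N}\|f(n)\|$; $L^p(V,X)$ denotes $X^N$ with $\|\cdot\|_p$. $U$ is the $N\times N$ unitary matrix whose $k$-th column is $u_k=(u_k(1),\dots,u_k(N))$, i.e. its entry in row $n$, column $k$ is $u_k(n)$; its $n$-th row is $u(n)=(u_1(n),\dots,u_N(n))$; $U^*$ is its conjugate transpose. Graph Fourier transform: $\mathcal{F}:X^N\to X^N$, $\mathcal{F}f=\hat f$, $\hat f(k)=\sum_{n=1}^N\overline{u_k(n)}f(n)$. Coherence: $\|U\|_\infty=\max_{k,n}|u_k(n)|$, and for $r\in[1,\infty]$, $\kappa_r(U)=\max_{1\le k\le N}\|u_k\|_r$, where $\|\cdot\|_r$ is the usual $\ell^r$ norm on $\mathbb{K}^N$ (maximum over columns); hence $\kappa_r(U^* )=\max_{1\le n\le N}\|u(n)\|_r$. The conjugate exponent satisfies $1/p+1/p'=1$. A topological isomorphism is a linear bijection that is continuous with continuous inverse; $\|\cdot\|_{p\to q}$ is the operator norm from $L^p(V,X)$ to $L^q(V,X)$. *)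

(* Defs.v *)
From HB Require Import structures.
From mathcomp Require Import all_boot all_order all_algebra.
From mathcomp Require Import all_classical all_reals all_analysis.
From mathcomp Require Import complex.
From mathcomp Require Import ring lra.

Set Implicit Arguments.
Unset Strict Implicit.
Unset Printing Implicit Defensive.

Import Order.TTheory GRing.Theory Num.Theory.
Import numFieldNormedType.Exports.

Local Open Scope classical_set_scope.
Local Open Scope ring_scope.

(** "K is R or C": the scalar field is selected by a tag, so that one
    statement quantified over the tag covers both cases. *)

Variant scalar_kind := RealScalars | ComplexScalars.

Definition scalar_field (R : realType) (k : scalar_kind) : numFieldType :=
  match k with
  | RealScalars => R
  | ComplexScalars => R[i]
  end.

Definition conjK (R : realType) (k : scalar_kind) :
    scalar_field R k -> scalar_field R k :=
  match k with
  | RealScalars => fun x => x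
  | ComplexScalars => fun z : R[i] => Num.conj z
  end.

Definition ReK (R : realType) (k : scalar_kind) : scalar_field R k -> R :=
  match k with
  | RealScalars => fun x => x
  | ComplexScalars => fun z : R[i] => complex.Re z
  end.

Definition injK (R : realType) (k : scalar_kind) : R -> scalar_field R k :=
  match k with
  | RealScalars => fun x => x
  | ComplexScalars => fun x => (x%:C)%C
  end.

Section Signals.
Context {R : realType} {k : scalar_kind}.
Local Notation K := (scalar_field R k).

(** The norm [`|x|] of a normed module over [K] takes its values in [K];
    [rnorm] is the same norm seen as a real number. *)
Definition rnorm (X : normedZmodType K) (x : X) : R := ReK `|x|.

(** The value at [-oo] is irrelevant. *)
Definition pnorm (X : normedZmodType K) (N : nat) (p : \bar R)
    (f : {ffun 'I_N -> X}) : R :=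
  match p with
  | r%:E => (\sum_(n < N) rnorm (f n) `^ r) `^ r^-1
  | +oo%E => \big[Num.max/0]_(n < N) rnorm (f n)
  | -oo%E => 0
  end.

Definition colnorm (N : nat) (r : \bar R) (v : 'cV[K]_N) : R :=
  pnorm r [ffun n => v n 0].

Definition orthonormal_basis (N : nat) (u : 'I_N -> 'cV[K]_N) : Prop :=
  basis_of fullv (codom u) /\
  forall j l : 'I_N,
    \sum_(n < N) u j n 0 * conjK (u l n 0) = (j == l)%:R.

Definition basis_mx (N : nat) (u : 'I_N -> 'cV[K]_N) : 'M[K]_N :=
  \matrix_(n, j) u j n 0.

Definition adjoint_mx (N : nat) (U : 'M[K]_N) : 'M[K]_N :=
  map_mx (@conjK R k) U^T.

Definition coherence (N : nat) (U : 'M[K]_N) : R :=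
  \big[Num.max/0]_(j < N) \big[Num.max/0]_(n < N) rnorm (U n j).

Definition kappa (N : nat) (r : \bar R) (U : 'M[K]_N) : R :=
  \big[Num.max/0]_(j < N) colnorm r (col j U).

Definition gft (X : lmodType K) (N : nat) (u : 'I_N -> 'cV[K]_N)
    (f : {ffun 'I_N -> X}) : {ffun 'I_N -> X} :=
  [ffun j => \sum_(n < N) conjK (u j n 0) *: f n].

End Signals.

Section ScalarTheory.
Context {R : realType} {k : scalar_kind}.
Local Notation K := (scalar_field R k).

Lemma injKD (a b : R) : injK k (a + b) = injK k a + injK k b.
Proof. by case: k => //=; rewrite rmorphD. Qed.

Lemma injKM (a b : R) : injK k (a * b) = injK k a * injK k b.
Proof. by case: k => //=; rewrite rmorphM. Qed.

Lemma injK0 : injK k (0 : R) = 0.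
Proof. by case: k => //=; rewrite rmorph0. Qed.

Lemma injK_le (a b : R) : (injK k a <= injK k b) = (a <= b).
Proof. by case: k => //=; rewrite lecR. Qed.

Lemma injK_inj : injective (@injK R k).
Proof. by case: k => // a b /= []. Qed.

Lemma injK_rnorm (X : normedZmodType K) (x : X) : injK k (rnorm x) = `|x|.
Proof.
rewrite /rnorm; case: k X x => //= X x.
have: 0 <= `|x| by exact: normr_ge0.
by case: `|x| => a b; rewrite lecE /= => /andP[/eqP-> _].
Qed.

Lemma rnorm_ge0 (X : normedZmodType K) (x : X) : 0 <= rnorm x.
Proof. by rewrite -injK_le injK_rnorm injK0. Qed.

Lemma ler_rnormD (X : normedZmodType K) (x y : X) :
  rnorm (x + y) <= rnorm x + rnorm y.
Proof. by rewrite -injK_le injKD !injK_rnorm ler_normD. Qed.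

Lemma rnormZ (X : normedModType K) (l : K) (x : X) :
  rnorm (l *: x) = rnorm l * rnorm x.
Proof. by apply: injK_inj; rewrite injKM !injK_rnorm normrZ. Qed.

Lemma rnorm_eq0 (X : normedZmodType K) (x : X) : rnorm x = 0 -> x = 0.
Proof. by move=> x0; apply/normr0_eq0; rewrite -injK_rnorm x0 injK0. Qed.

End ScalarTheory.

Section FiniteMinkowski.
Context {R : realType}.
Implicit Types (r : R) (N : nat).

Lemma psum_ge0 N r (a : 'I_N -> R) : 0 <= \sum_n a n `^ r.
Proof. by apply: sumr_ge0 => n _; exact: powR_ge0. Qed.

Lemma powR_invK r (x : R) : 1 <= r -> 0 <= x -> (x `^ r^-1) `^ r = x.
Proof.
move=> r1 x0; rewrite -powRrM mulVf ?powRr1//.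
by rewrite gt_eqF// (lt_le_trans ltr01).
Qed.

Lemma powR_Kinv r (x : R) : 1 <= r -> 0 <= x -> (x `^ r) `^ r^-1 = x.
Proof.
move=> r1 x0; rewrite -powRrM mulfV ?powRr1//.
by rewrite gt_eqF// (lt_le_trans ltr01).
Qed.

Lemma psum_eq0 N r (a : 'I_N -> R) : 1 <= r ->
  (\sum_n a n `^ r) `^ r^-1 = 0 -> forall n, a n = 0.
Proof.
move=> r1 /powR_eq0_eq0 /eqP.
rewrite psumr_eq0; last by move=> n _; exact: powR_ge0.
by move=> /allP h n; apply/powR_eq0_eq0/eqP/(implyP (h n _)); rewrite ?mem_index_enum.
Qed.

Lemma psumZ N r (c : R) (a : 'I_N -> R) : 1 <= r -> 0 <= c ->
  (forall n, 0 <= a n) ->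
  (\sum_n (c * a n) `^ r) `^ r^-1 = c * (\sum_n a n `^ r) `^ r^-1.
Proof.
move=> r1 c0 a0.
under eq_bigr do rewrite powRM//.
by rewrite -mulr_sumr powRM ?powR_ge0 ?psum_ge0// powR_Kinv.
Qed.

Lemma finite_minkowski N r (a b : 'I_N -> R) : 1 <= r ->
  (forall n, 0 <= a n) -> (forall n, 0 <= b n) ->
  (\sum_n (a n + b n) `^ r) `^ r^-1 <=
  (\sum_n a n `^ r) `^ r^-1 + (\sum_n b n `^ r) `^ r^-1.
Proof.
move=> r1 a0 b0.
have r0 : 0 <= r by exact: le_trans r1.
move eA: ((\sum_n a n `^ r) `^ r^-1) => A.
move eB: ((\sum_n b n `^ r) `^ r^-1) => B.
have A0 : 0 <= A by rewrite -eA; exact: powR_ge0.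
have B0 : 0 <= B by rewrite -eB; exact: powR_ge0.
have [A_eq0|An0] := eqVneq A 0.
  under eq_bigr => n _ do rewrite (psum_eq0 r1 (etrans eA A_eq0) n) add0r.
  by rewrite eB lerDr.
have [B_eq0|Bn0] := eqVneq B 0.
  under eq_bigr => n _ do rewrite (psum_eq0 r1 (etrans eB B_eq0) n) addr0.
  by rewrite eA lerDl.
have Ap : 0 < A by rewrite lt0r An0.
have Bp : 0 < B by rewrite lt0r Bn0.
have ABp : 0 < A + B by exact: addr_gt0.
have t01 : 0 <= A / (A + B) <= 1.
  by rewrite divr_ge0 ?(ltW ABp)//= ler_pdivrMr// mul1r lerDl.
pose t : {i01 R} := Itv01 (proj1 (andP t01)) (proj2 (andP t01)).
have tE : t%:num = A / (A + B) by [].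
have key n : (a n + b n) `^ r <= (A + B) `^ r *
    (A / (A + B) * (a n / A) `^ r + B / (A + B) * (b n / B) `^ r).
  have -> : a n + b n =
      (A + B) * (A / (A + B) * (a n / A) + B / (A + B) * (b n / B)).
    by field; rewrite An0 Bn0 gt_eqF.
  have AB0 := ltW ABp.
  rewrite powRM//; last by rewrite addr_ge0// mulr_ge0// divr_ge0.
  apply: ler_wpM2l; first exact: powR_ge0.
  have an0 : a n / A \in (`[0, +oo[%classic : set R).
    by rewrite inE/= in_itv/= andbT divr_ge0.
  have bn0 : b n / B \in (`[0, +oo[%classic : set R).
    by rewrite inE/= in_itv/= andbT divr_ge0.
  have := @convex_powR R r r1 t _ _ an0 bn0.
  rewrite convRE [X in X `^ _ <= _ -> _]convRE tE.
  have -> : unstable.onem (A / (A + B)) = B / (A + B); last by [].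
  by apply: (addrI (A / (A + B))); rewrite unstable.add_onemK -mulrDl divff// gt_eqF.
have sA : \sum_n (a n / A) `^ r = 1.
  have -> : \sum_n (a n / A) `^ r = \sum_n A^-1 `^ r * a n `^ r.
    by apply: eq_bigr => n _; rewrite mulrC powRM ?invr_ge0.
  rewrite -mulr_sumr -(powR_invK r1 (psum_ge0 r a)) eA -powRM ?invr_ge0//.
  by rewrite mulVf// powR1.
have sB : \sum_n (b n / B) `^ r = 1.
  have -> : \sum_n (b n / B) `^ r = \sum_n B^-1 `^ r * b n `^ r.
    by apply: eq_bigr => n _; rewrite mulrC powRM ?invr_ge0.
  rewrite -mulr_sumr -(powR_invK r1 (psum_ge0 r b)) eB -powRM ?invr_ge0//.
  by rewrite mulVf// powR1.
rewrite -[leRHS](powR_Kinv r1) ?(ltW ABp)//.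
apply: ge0_ler_powR; rewrite ?nnegrE ?invr_ge0 ?powR_ge0 ?psum_ge0//.
apply: le_trans (ler_sum _ (fun n _ => key n)) _.
rewrite -mulr_sumr big_split/= -!mulr_sumr sA sB !mulr1 -mulrDl.
by rewrite divff ?mulr1// gt_eqF.
Qed.

End FiniteMinkowski.

Section PnormTheory.
Context {R : realType} {k : scalar_kind}.
Local Notation K := (scalar_field R k).
Variables (X : normedModType K) (N : nat) (p : \bar R).
Hypothesis p1 : (1 <= p)%E.
Implicit Types f g : {ffun 'I_N -> X}.

Lemma pnorm_ge0 f : 0 <= pnorm p f.
Proof.
case: p => [r| |] //=; first exact: powR_ge0.
by elim/big_ind: _ => // [x y x0 y0|n _]; rewrite ?le_max ?x0 ?rnorm_ge0.
Qed.

Lemma ler_pnormD f g : pnorm p (f + g) <= pnorm p f + pnorm p g.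
Proof.
case: p p1 => [r| |] //=; last first.
- move=> _; apply: bigmax_le => [|n _].
    by apply: addr_ge0; exact: bigmax_ge_id.
  rewrite ffunE (le_trans (ler_rnormD _ _))// lerD//.
    by apply: (le_bigmax _ (fun n => rnorm (f n))).
  by apply: (le_bigmax _ (fun n => rnorm (g n))).
rewrite lee_fin => r1.
apply: le_trans (finite_minkowski r1 (fun n => rnorm_ge0 (f n))
  (fun n => rnorm_ge0 (g n))).
have r0 : 0 <= r by exact: le_trans r1.
apply: ge0_ler_powR; rewrite ?nnegrE ?invr_ge0 ?psum_ge0//.
apply: ler_sum => n _; rewrite ffunE.
by apply: ge0_ler_powR; rewrite ?nnegrE ?addr_ge0 ?rnorm_ge0 ?ler_rnormD.
Qed.

Lemma pnormZ (l : K) f : pnorm p (l *: f) = rnorm l * pnorm p f.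
Proof.
case: p p1 => [r| |] //=; last first.
- move=> _; under eq_bigr do rewrite ffunE rnormZ.
  elim/big_ind2: _ => [|x1 x2 y1 y2 -> ->|//]; first by rewrite mulr0.
  by rewrite maxr_pMr// rnorm_ge0.
rewrite lee_fin => r1.
under eq_bigr do rewrite ffunE rnormZ.
by apply: psumZ => // [|n]; exact: rnorm_ge0.
Qed.

Lemma pnorm_eq0 f : pnorm p f = 0 -> f = 0.
Proof.
move=> f0; apply/ffunP => n; rewrite ffunE; apply: rnorm_eq0; move: f0.
case: p p1 => [r| |] //=; last first.
- move=> _ f0; apply/eqP; rewrite eq_le rnorm_ge0 andbT -f0.
  by apply: (le_bigmax _ (fun n => rnorm (f n))).
by rewrite lee_fin => r1 /(psum_eq0 r1) ->.
Qed.

End PnormTheory.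

(** [X^N] with the norm [pnorm p] (see [rnorm_LpE]); the proof of [1 <= p] is a
    parameter of the type because the triangle inequality needs it. *)
Definition Lp (R : realType) (k : scalar_kind) (X : normedModType (scalar_field R k))
    (N : nat) (p : \bar R) (p1 : (1 <= p)%E) : Type :=
  {ffun 'I_N -> X}.

Section LpNormed.
Context {R : realType} {k : scalar_kind}.
Local Notation K := (scalar_field R k).
Variables (X : normedModType K) (N : nat) (p : \bar R) (p1 : (1 <= p)%E).
Local Notation L := (Lp X N p1).

HB.instance Definition _ := GRing.Lmodule.on L.

Let norm (f : L) : K := injK k (pnorm p f).

Let ler_normD (f g : L) : norm (f + g) <= norm f + norm g.
Proof. by rewrite -injKD injK_le; exact: ler_pnormD. Qed.

Let normrZ (l : K) (f : L) : norm (l *: f) = `|l| * norm f.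
Proof. by rewrite /norm pnormZ// injKM injK_rnorm. Qed.

Let normr0_eq0 (f : L) : norm f = 0 -> f = 0.
Proof. by rewrite -injK0 => /injK_inj /(pnorm_eq0 p1). Qed.

HB.instance Definition _ :=
  Lmodule_isNormed.Build K L ler_normD normrZ normr0_eq0.

Lemma rnorm_LpE (f : L) : rnorm f = pnorm p f.
Proof. by apply: (@injK_inj R k); rewrite injK_rnorm. Qed.

End LpNormed.

Section Operators.
Context {R : realType} {k : scalar_kind}.
Local Notation K := (scalar_field R k).
Variables E G : normedModType K.

Definition topological_isomorphism (T : E -> G) : Prop :=
  [/\ linear T, continuous T &
      exists S : G -> E, [/\ cancel T S, cancel S T & continuous S]].

Definition opnorm (T : E -> G) : \bar R :=
  ereal_sup [set (rnorm (T x))%:E | x in [set x : E | rnorm x <= 1]].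

End Operators.

(* Main.v *)
Require Import Defs.
From HB Require Import structures.
From mathcomp Require Import all_boot all_order all_algebra.
From mathcomp Require Import all_classical all_reals all_analysis.
From mathcomp Require Import complex ring.

(** The Fourier transform and its inverse are both the action of a scalar
    matrix on vector-valued signals, [(A f)(j) = \sum_n A j n *: f n]
    ([mxact]): for the transform [A] is the adjoint of [U], for its inverse
    [A] is [U] itself, because orthonormality of the columns says that
    [adjoint_mx U *m U] is the identity. Everything therefore reduces to one
    fact about an arbitrary matrix: the operator norm of its action from [L^p]
    to [L^oo] is the largest [l^p'] norm of its rows.

    The upper bound ([pnorm_mxact_le]) is the triangle inequality in [X]
    followed by Hoelder's inequality for each row. The lower bound
    ([opnorm_mxact]) uses the equality case of Hoelder's inequality: a
    nonnegative sequence [t] of [l^p] norm at most 1 that attains the [l^p']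
    norm of the moduli of row [j] ([hoelder_sum_eq]) is multiplied by the
    phases that turn each [A j n] into its modulus, and then by a unit vector
    of [X]; this gives a signal in the unit ball of [L^p] whose image has
    exactly the norm of row [j] at the vertex [j] ([exists_row_extremal]). The
    unit vector is where [X != 0] enters.

    Rows of [adjoint_mx U] have the norms of the columns of [U], so the norms
    obtained are the numbers [kappa]. For [p = 1] the row norm is the largest
    modulus of an entry, which gives the coherence of [U]; for [p = 2] it is 1
    by unitarity. Finally, a linear map with an explicit bound is continuous,
    and any [L^p] norm on [N] points is at most a constant times the sup norm,
    so the inverse is bounded from [L^oo] to [L^p] as well. *)

Import Order.TTheory GRing.Theory Num.Theory.
Import numFieldNormedType.Exports.

Local Open Scope ring_scope.

Set Implicit Arguments.
Unset Strict Implicit.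
Unset Printing Implicit Defensive.

(** * Hoelder's inequality for finite sequences, with its equality case *)

Section RealSequences.
Context {R : realType} {N : nat}.
Implicit Types (p : \bar R) (r s : R) (a b t : 'I_N -> R).

(** [pnorm] applied to the sequence of the norms of a signal ([pnormE]):
    Hoelder's inequality is about these nonnegative reals only. *)
Definition lnorm p b : R :=
  match p with
  | r%:E => (\sum_(n < N) b n `^ r) `^ r^-1
  | +oo%E => \big[Num.max/0]_(n < N) b n
  | -oo%E => 0
  end.

#[local] Arguments lnorm : simpl never.

Lemma eq_lnorm p a b : a =1 b -> lnorm p a = lnorm p b.
Proof. by move=> /funext ->. Qed.

Lemma lnorm1 b : (forall n, 0 <= b n) -> lnorm 1%E b = \sum_n b n.
Proof.
move=> b0; rewrite /lnorm invr1 powRr1 ?psum_ge0//.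
by apply: eq_bigr => n _; rewrite powRr1.
Qed.

Lemma lnorm_ge0 p b : 0 <= lnorm p b.
Proof. by case: p => [r| |]; rewrite /lnorm ?powR_ge0//; exact: bigmax_ge_id. Qed.

Lemma sum_powR_normalized r b : 1 <= r -> (forall n, 0 <= b n) ->
  lnorm r%:E b != 0 -> \sum_n (b n / lnorm r%:E b) `^ r = 1.
Proof.
move=> r1 b0 B0; set B := lnorm r%:E b.
have iB0 : 0 <= B^-1 by rewrite invr_ge0 lnorm_ge0.
under eq_bigr do rewrite mulrC.
rewrite -(powR_invK r1 (psum_ge0 _ _)) psumZ//.
by rewrite -[X in B^-1 * X]/B mulVf// powR1.
Qed.

Lemma hoelder_conjugate_cases p : (1 <= p)%E ->
  [\/ p = 1%E /\ hoelder_conjugate p = +oo%E,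
      p = +oo%E /\ hoelder_conjugate p = 1%E
    | exists r s, [/\ p = r%:E, hoelder_conjugate p = s%:E,
                      1 < r, 1 < s & r^-1 + s^-1 = 1]].
Proof.
case: p => [r| |] //; last by constructor 2; rewrite hoelder_conjugatey.
rewrite lee_fin le_eqVlt => /predU1P[<-|r1].
  by constructor 1; rewrite hoelder_conjugate1.
constructor 3; exists r, (r / (r - 1)).
have r0 : 0 < r by exact: lt_trans r1.
have r10 : 0 < r - 1 by rewrite subr_gt0.
split=> //.
- rewrite /hoelder_conjugate/= eqe gt_eqF//= -EFinB inver gt_eqF//.
- by rewrite ltr_pdivlMr// mul1r ltrBlDr ltrDl ltr01.
- by field; rewrite !gt_eqF.
Qed.

(** For [1 < p < +oo]: after division of [a] and [b] by their norms, Young's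
    inequality bounds the sum by [1/p' + 1/p = 1]. *)
Lemma hoelder_sum p a b : (1 <= p)%E ->
  (forall n, 0 <= a n) -> (forall n, 0 <= b n) ->
  \sum_n a n * b n <= lnorm (hoelder_conjugate p) a * lnorm p b.
Proof.
move=> p1 a0 b0.
have [[-> ->]|[-> ->]|[r [s [-> -> r1 s1 rs]]]] := hoelder_conjugate_cases p1.
- rewrite lnorm1// mulr_sumr; apply: ler_sum => n _.
  by apply: ler_wpM2r => //; exact: (le_bigmax _ a).
- rewrite lnorm1// mulr_suml; apply: ler_sum => n _.
  by apply: ler_wpM2l => //; exact: (le_bigmax _ b).
have [A0|A0] := eqVneq (lnorm s%:E a) 0.
  rewrite A0 mul0r big1// => n _.
  by rewrite (psum_eq0 (ltW s1) A0) mul0r.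
have [B0|B0] := eqVneq (lnorm r%:E b) 0.
  rewrite B0 mulr0 big1// => n _.
  by rewrite (psum_eq0 (ltW r1) B0) mulr0.
have := sum_powR_normalized (ltW s1) a0 A0.
have := sum_powR_normalized (ltW r1) b0 B0.
have := lnorm_ge0 r%:E b; have := lnorm_ge0 s%:E a.
move: (lnorm s%:E a) (lnorm r%:E b) A0 B0 => A B A0 B0 A_ge0 B_ge0 sB sA.
have -> : \sum_n a n * b n = A * B * \sum_n (a n / A) * (b n / B).
  rewrite mulr_sumr; apply: eq_bigr => n _.
  by rewrite mulrACA [A * _]mulrC [B * _]mulrC (divfK A0) (divfK B0).
rewrite ler_piMr ?mulr_ge0//.
apply: (@le_trans _ _ (\sum_n ((a n / A) `^ s / s + (b n / B) `^ r / r))).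
  apply: ler_sum => n _; apply: conjugate_powR; rewrite ?divr_ge0//.
  - exact: lt_trans s1.
  - exact: lt_trans r1.
  - by rewrite addrC.
rewrite big_split/= -!mulr_suml sA sB.
by rewrite !mul1r addrC rs.
Qed.

(** Equality holds for the indicator of an index where [a] is largest if
    [p = 1], for the constant 1 if [p = +oo], and for a multiple of the power
    [a `^ (p' - 1)] otherwise. *)
Lemma hoelder_sum_eq p a : (1 <= p)%E -> (forall n, 0 <= a n) ->
  exists t, [/\ forall n, 0 <= t n, lnorm p t <= 1 &
    \sum_n a n * t n = lnorm (hoelder_conjugate p) a].
Proof.
move=> p1 a0.
have [[-> ->]|[-> ->]|[r [s [-> -> r1 s1 rs]]]] := hoelder_conjugate_cases p1.
- have [n0 _|N0] := pickP 'I_N; last first.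
    exists (fun=> 0); split=> [//||]; first by rewrite lnorm1// big_pred0 ?ler01.
    by rewrite /lnorm !big_pred0.
  have [m aE] : exists m, lnorm +oo%E a = a m.
    by eexists; exact: (bigmax_eq_arg 0 n0 predT a erefl (fun n _ => a0 n)).
  have delta0 n : n != m -> (n == m)%:R = 0 :> R by move=> /negbTE->.
  exists (fun n => (n == m)%:R); split=> [n||]; first exact: ler0n.
    rewrite lnorm1 => [|n]; last exact: ler0n.
    by rewrite (bigD1 m)//= eqxx big1 ?addr0.
  by rewrite aE (bigD1 m)//= eqxx mulr1 big1 ?addr0// => n /delta0->; rewrite mulr0.
- exists (fun=> 1); split=> [//||]; first by apply: bigmax_le.
  by rewrite lnorm1//; apply: eq_bigr => n _; rewrite mulr1.
have [A0|A0] := eqVneq (lnorm s%:E a) 0.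
  have r0 : r != 0 by rewrite gt_eqF// (lt_trans ltr01).
  exists (fun=> 0); split=> [//||]; last by rewrite A0 big1// => n; rewrite mulr0.
  by rewrite /lnorm big1 ?powR0 ?invr_eq0// => n _; rewrite powR0.
have := sum_powR_normalized (ltW s1) a0 A0; have := lnorm_ge0 s%:E a.
move: (lnorm s%:E a) A0 => A A0 A_ge0 sA.
have s0 : 0 < s by exact: lt_trans s1.
have r0 : 0 < r by exact: lt_trans r1.
(* Raising the extremal sequence [(a n / A) `^ (s - 1)] to the power [r] gives
   [(a n / A) `^ s], which sums to 1. *)
have sr : (s - 1) * r = s.
  have: (r^-1 + s^-1) * (r * s) = r * s by rewrite rs mul1r.
  rewrite mulrDl mulrA mulVf ?gt_eqF// mul1r mulrCA mulVf ?gt_eqF// mulr1 => h.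
  by rewrite mulrBl mul1r [s * r]mulrC -h addrK.
exists (fun n => (a n / A) `^ (s - 1)); split=> [n||]; first exact: powR_ge0.
- rewrite /lnorm; under eq_bigr do rewrite -powRrM sr.
  by rewrite sA powR1.
- transitivity (A * \sum_n (a n / A) `^ s); last by rewrite sA mulr1.
  rewrite mulr_sumr; apply: eq_bigr => n _.
  rewrite -[(a n / A) `^ s]mulr_powRB1 ?divr_ge0//.
  by rewrite mulrA [A * _]mulrC divfK.
Qed.

Lemma ler_lnorm p a b : (1 <= p)%E -> (forall n, 0 <= a n) ->
  (forall n, a n <= b n) -> lnorm p a <= lnorm p b.
Proof.
move=> + a0 ab; have b0 n : 0 <= b n by exact: le_trans (ab n).
case: p => [r| |]//.
  rewrite lee_fin => r1; have r0 : 0 <= r by exact: le_trans r1.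
  apply: ge0_ler_powR; rewrite ?nnegrE ?invr_ge0 ?psum_ge0//.
  by apply: ler_sum => n _; apply: ge0_ler_powR; rewrite ?nnegrE.
by move=> _; apply: le_bigmax2.
Qed.

(** Quantifies the equivalence of the [l^p] norm with the sup norm, which makes
    the inverse transform continuous from [L^oo] to [L^p]. *)
Lemma lnorm_le_const p a c : (1 <= p)%E -> 0 <= c -> (forall n, 0 <= a n <= c) ->
  lnorm p a <= c * lnorm p (fun=> 1).
Proof.
move=> + c0 ac; case: p => [r| |]// => [r1|_]; last first.
  apply: bigmax_le => [|n _]; first by rewrite mulr_ge0// lnorm_ge0.
  have /andP[_ /le_trans->//] := ac n.
  by rewrite ler_peMr//; exact: (le_bigmax _ (fun=> 1) n).
rewrite /lnorm -psumZ//; apply: (ler_lnorm r1) => n; first by case/andP: (ac n).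
by rewrite mulr1; case/andP: (ac n).
Qed.

End RealSequences.

(** * Conjugation and real-valued norms over both scalar fields *)

Section Scalars.
Context {R : realType} {k : scalar_kind}.
Local Notation K := (scalar_field R k).

Lemma injK1 : injK k (1 : R) = 1.
Proof. by case: k. Qed.

Lemma injK_sum (I : finType) (b : I -> R) :
  injK k (\sum_i b i) = \sum_i injK k (b i).
Proof. by apply: (big_morph _ (@injKD R k)); exact: injK0. Qed.

Lemma rnorm_injK (x : R) : 0 <= x -> rnorm (injK k x) = x.
Proof.
move=> x0; apply: (@injK_inj R k); rewrite injK_rnorm ger0_norm//.
by rewrite -injK0 injK_le.
Qed.

Lemma rnormM (x y : K) : rnorm (x * y) = rnorm x * rnorm y.
Proof. by apply: (@injK_inj R k); rewrite injKM !injK_rnorm normrM. Qed.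

Lemma rnorm0 (X : normedZmodType K) : rnorm (0 : X) = 0.
Proof. by apply: (@injK_inj R k); rewrite injK_rnorm injK0 normr0. Qed.

Lemma ler_rnorm_sum (X : normedZmodType K) (I : finType) (F : I -> X) :
  rnorm (\sum_i F i) <= \sum_i rnorm (F i).
Proof.
rewrite -(@injK_le R k) injK_rnorm injK_sum.
by under [leRHS]eq_bigr do rewrite injK_rnorm; exact: ler_norm_sum.
Qed.

Lemma conjKK : involutive (@conjK R k).
Proof. by case: k => //= x; rewrite conjCK. Qed.

Lemma conjK_mul (x : K) : conjK x * x = injK k (rnorm x ^+ 2).
Proof.
rewrite expr2 injKM injK_rnorm -expr2.
by case: k x => /= x; [rewrite real_normK ?num_real// expr2|rewrite normCK mulrC].
Qed.

Lemma rnorm_conjK (x : K) : rnorm (conjK x) = rnorm x.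
Proof.
apply: (@injK_inj R k); rewrite !injK_rnorm.
by case: k x => //= x; rewrite norm_conjC.
Qed.

Lemma exists_phase (x : K) : exists2 e : K, rnorm e <= 1 & x * e = injK k (rnorm x).
Proof.
have [->|x0] := eqVneq x 0.
  by exists 0; rewrite ?rnorm0 ?injK0 ?mul0r.
exists (`|x| / x); last by rewrite injK_rnorm mulrC divfK.
rewrite -(@injK_le R k) injK_rnorm injK1 normrM normfV normr_id divff//.
by rewrite normr_eq0.
Qed.

End Scalars.

(** * Matrices acting on vector-valued signals *)

Section MatrixAction.
Context {R : realType} {k : scalar_kind} {X : normedModType (scalar_field R k)}.
Context {N : nat}.
Local Notation K := (scalar_field R k).
Implicit Types (A B : 'M[K]_N) (f : {ffun 'I_N -> X}) (p : \bar R).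

Definition mxact A f : {ffun 'I_N -> X} := [ffun j => \sum_n A j n *: f n].

Lemma gftE (u : 'I_N -> 'cV[K]_N) f : gft u f = mxact (adjoint_mx (basis_mx u)) f.
Proof. by apply/ffunP => j; rewrite !ffunE; apply: eq_bigr => n _; rewrite !mxE. Qed.

Lemma adjoint_mxK A : adjoint_mx (adjoint_mx A) = A.
Proof. by apply/matrixP => i j; rewrite !mxE conjKK. Qed.

Lemma mxactM A B f : mxact A (mxact B f) = mxact (A *m B) f.
Proof.
apply/ffunP => i; rewrite !ffunE.
under eq_bigr do rewrite ffunE scaler_sumr.
rewrite exchange_big; apply: eq_bigr => n _; rewrite mxE scaler_suml.
by apply: eq_bigr => j _; rewrite scalerA.
Qed.

Lemma mxact1 f : mxact 1%:M f = f.
Proof.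
apply/ffunP => i; rewrite ffunE (bigD1 i)//= mxE eqxx scale1r.
by rewrite big1 ?addr0// => n ni; rewrite mxE eq_sym (negbTE ni) scale0r.
Qed.

Lemma mxact_linear A (c : K) f g : mxact A (c *: f + g) = c *: mxact A f + mxact A g.
Proof.
apply/ffunP => i; rewrite !ffunE scaler_sumr -big_split/=.
by apply: eq_bigr => n _; rewrite !ffunE scalerDr !scalerA mulrC.
Qed.

Lemma pnormE (Y : normedZmodType K) p (f : {ffun 'I_N -> Y}) :
  pnorm p f = lnorm p (fun n => rnorm (f n)).
Proof. by case: p. Qed.

Lemma colnorm_adjoint p A j :
  colnorm p (col j (adjoint_mx A)) = lnorm p (fun n => rnorm (A j n)).
Proof.
by rewrite /colnorm pnormE; apply: eq_lnorm => n; rewrite ffunE !mxE rnorm_conjK.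
Qed.

Lemma kappa_ge0 p A : 0 <= kappa p A.
Proof. exact: bigmax_ge_id. Qed.

(** Column [j] of [adjoint_mx A] has the moduli of row [j] of [A], so this is
    Hoelder's inequality row by row. *)
Lemma pnorm_mxact_le p A f : (1 <= p)%E ->
  pnorm +oo%E (mxact A f) <=
  kappa (hoelder_conjugate p) (adjoint_mx A) * pnorm p f.
Proof.
move=> p1; apply: bigmax_le => [|j _].
  by rewrite mulr_ge0 ?kappa_ge0// pnormE lnorm_ge0.
rewrite ffunE (le_trans (ler_rnorm_sum _))//.
under eq_bigr do rewrite rnormZ.
apply: le_trans (hoelder_sum p1 (fun n => rnorm_ge0 _) (fun n => rnorm_ge0 _)) _.
rewrite -pnormE ler_wpM2r ?pnormE ?lnorm_ge0//.
rewrite -colnorm_adjoint.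
exact: (le_bigmax _ (fun j => colnorm _ (col j (adjoint_mx A)))).
Qed.

(** The signal [f n = e n * t n *: x], with [t] extremal in Hoelder's inequality
    for the moduli of row [j] and [e n] the phase for which [A j n * e n] is the
    modulus of [A j n]: no cancellation is left in [mxact A f j]. *)
Lemma exists_row_extremal p A (j : 'I_N) (x : X) : (1 <= p)%E -> rnorm x = 1 ->
  exists2 f, pnorm p f <= 1 &
    rnorm (mxact A f j) = colnorm (hoelder_conjugate p) (col j (adjoint_mx A)).
Proof.
move=> p1 x1.
have [t [t0 tp tE]] := hoelder_sum_eq p1 (fun n => rnorm_ge0 (A j n)).
have /choice[e eP] n : exists e : K, rnorm e <= 1 /\ A j n * e = injK k (rnorm (A j n)).
  by have [e] := exists_phase (A j n); exists e.
exists [ffun n => (e n * injK k (t n)) *: x].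
  apply: le_trans tp; rewrite pnormE.
  apply: ler_lnorm => // n; rewrite ?rnorm_ge0// ffunE rnormZ x1 mulr1.
  by rewrite rnormM rnorm_injK// ler_piMl//; case: (eP n).
rewrite ffunE.
under eq_bigr => n _.
  rewrite ffunE scalerA mulrA (eP n).2 -injKM; over.
rewrite -scaler_suml -injK_sum tE rnormZ x1 mulr1 rnorm_injK ?lnorm_ge0//.
by rewrite colnorm_adjoint.
Qed.

Lemma pnorm_le_pnormy p f : (1 <= p)%E ->
  pnorm p f <= pnorm +oo%E f * lnorm p (fun _ : 'I_N => 1).
Proof.
move=> p1; rewrite [leLHS]pnormE; apply: lnorm_le_const => // [|n].
  by rewrite pnormE lnorm_ge0.
by rewrite rnorm_ge0; exact: (le_bigmax _ (fun n => rnorm (f n))).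
Qed.

Lemma kappay A : kappa +oo%E A = coherence A.
Proof.
apply: eq_bigr => j _; rewrite /colnorm pnormE.
by apply: eq_bigr => n _; rewrite ffunE mxE.
Qed.

Lemma coherence_adjoint A : coherence (adjoint_mx A) = coherence A.
Proof.
have adj_le B : coherence (adjoint_mx B) <= coherence B.
  apply: bigmax_le => [|j _]; first exact: bigmax_ge_id.
  apply: bigmax_le => [|n _]; first exact: bigmax_ge_id.
  rewrite !mxE rnorm_conjK.
  apply: le_trans (le_bigmax _ (fun i => \big[Num.max/0]_m rnorm (B m i)) n).
  exact: (le_bigmax _ (fun m => rnorm (B m n))).
by apply/eqP; rewrite eq_le adj_le -[in leLHS](adjoint_mxK A) adj_le.
Qed.

(** The squared norm of column [j] is the diagonal entry [(j, j)] of
    [adjoint_mx A *m A]. *)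
Lemma kappa2_unitary_le1 A : adjoint_mx A *m A = 1%:M -> kappa 2%:E A <= 1.
Proof.
move=> AA; apply: bigmax_le => // j _; rewrite /colnorm pnormE.
have colE : \sum_n rnorm (A n j) ^+ 2 = 1.
  apply: (@injK_inj R k); rewrite injK_sum injK1.
  have := congr1 (fun B : 'M[K]_N => B j j) AA; rewrite !mxE eqxx mulr1n => <-.
  by apply: eq_bigr => n _; rewrite !mxE conjK_mul.
rewrite /lnorm; under eq_bigr do rewrite ffunE mxE powR_mulrn ?rnorm_ge0//.
by rewrite colE powR1.
Qed.

Lemma adjoint_basis_mxM (u : 'I_N -> 'cV[K]_N) : orthonormal_basis u ->
  adjoint_mx (basis_mx u) *m basis_mx u = 1%:M.
Proof.
move=> [_ uu]; apply/matrixP => l j; rewrite !mxE eq_sym -uu.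
by apply: eq_bigr => n _; rewrite !mxE mulrC.
Qed.

End MatrixAction.

(** * The action as an operator from [L^p] to [L^oo] *)

Lemma bounded_linear_rnorm_continuous (R : realType) (k : scalar_kind)
    (E G : normedModType (scalar_field R k)) (T : E -> G) (C : R) :
  linear T -> 0 <= C -> (forall x, rnorm (T x) <= C * rnorm x) -> continuous T.
Proof.
move=> linT C0 TC.
pose L : {linear E -> G} := HB.pack T (GRing.isLinear.Build _ E G _ T linT).
apply: (@bounded_linear_continuous _ E G L); apply/linear_boundedP.
have CR : injK k C \is Num.real by rewrite ger0_real// -injK0 injK_le.
apply: filterS (nbhs_pinfty_ge CR) => r Cr x.
apply: (@le_trans _ _ (injK k C * `|x|)); last by apply: ler_wpM2r.
by rewrite -!injK_rnorm -injKM injK_le; exact: TC.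
Qed.

Section Operator.
Context {R : realType} {k : scalar_kind} {X : normedModType (scalar_field R k)}.
Context {N : nat}.
Local Notation K := (scalar_field R k).

Lemma exists_unit_vector : (exists x : X, x <> 0) -> exists x : X, rnorm x = 1.
Proof.
move=> [x /eqP x0]; exists (`|x|^-1 *: x); apply: (@injK_inj R k).
by rewrite injK_rnorm normrZ normfV normr_id mulVf ?normr_eq0// injK1.
Qed.

(** [pnorm_mxact_le] is sharp: the extremal signal of each row lies in the unit
    ball and is mapped to a signal of sup norm at least the norm of that row. *)
Lemma opnorm_mxact p (p1 : (1 <= p)%E) (A : 'M[K]_N) :
  (exists x : X, x <> 0) ->
  opnorm (mxact A : Lp X N p1 -> Lp X N (leey 1%E)) =
  (kappa (hoelder_conjugate p) (adjoint_mx A))%:E.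
Proof.
move=> /exists_unit_vector[x x1]; apply/eqP; rewrite eq_le; apply/andP; split.
  apply: ge_ereal_sup => _ [f /= f1 <-]; rewrite lee_fin.
  rewrite rnorm_LpE (le_trans (pnorm_mxact_le A f p1))//.
  by rewrite ler_piMr ?kappa_ge0// -rnorm_LpE.
have sup_ge (f : Lp X N p1) (c : R) : pnorm p f <= 1 ->
    c <= pnorm +oo%E (mxact A f) ->
    (c%:E <= opnorm (mxact A : Lp X N p1 -> Lp X N (leey 1%E)))%E.
  move=> f1 cf; apply: ereal_sup_ge; exists (pnorm +oo%E (mxact A f))%:E => //.
  by exists f; rewrite /= rnorm_LpE.
rewrite /kappa; elim/big_ind: _ => [|a b|j _].
- apply: (sup_ge 0); last by rewrite pnormE lnorm_ge0.
  by rewrite -(rnorm_LpE (0 : Lp X N p1)) rnorm0.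
- by rewrite EFin_max ge_max => -> ->.
have [f f1 <-] := exists_row_extremal A j p1 x1.
by apply: (sup_ge f) => //; exact: (le_bigmax _ (fun n => rnorm (mxact A f n))).
Qed.

Lemma mxact_topological_isomorphism p (p1 : (1 <= p)%E) (A B : 'M[K]_N) :
  A *m B = 1%:M ->
  topological_isomorphism (mxact A : Lp X N p1 -> Lp X N (leey 1%E)).
Proof.
move=> AB; have BA := mulmx1C AB; split.
- exact: mxact_linear.
- apply: bounded_linear_rnorm_continuous; first exact: mxact_linear.
    exact: (kappa_ge0 (hoelder_conjugate p) (adjoint_mx A)).
  by move=> f; rewrite !rnorm_LpE; exact: pnorm_mxact_le.
exists (mxact B); split=> [f|f|].
- by rewrite mxactM BA mxact1.
- by rewrite mxactM AB mxact1.
apply: (@bounded_linear_rnorm_continuous _ _ _ _ _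
  (kappa (hoelder_conjugate +oo%E) (adjoint_mx B) * lnorm p (fun _ : 'I_N => 1))).
- exact: mxact_linear.
- by rewrite mulr_ge0 ?kappa_ge0 ?lnorm_ge0.
move=> f; rewrite !rnorm_LpE (le_trans (pnorm_le_pnormy _ p1))//.
by rewrite mulrAC ler_wpM2r ?lnorm_ge0// pnorm_mxact_le ?leey.
Qed.

End Operator.

Theorem theorem2p1 (R : realType) (k : scalar_kind)
    (X : completeNormedModType (scalar_field R k)) (X_neq0 : exists x : X, x <> 0)
    (N : nat) (N_ge1 : (1 <= N)%N)
    (u : 'I_N -> 'cV[scalar_field R k]_N) (u_onb : orthonormal_basis u)
    (p : \bar R) (p_ge1 : (1 <= p)%E) :
  let U := basis_mx u in
  let p' := hoelder_conjugate p in
  let F : Lp X N p_ge1 -> Lp X N (leey 1%E) := gft u in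
  [/\ forall f : {ffun 'I_N -> X},
        pnorm +oo%E (gft u f) <= kappa p' U * pnorm p f /\
        pnorm +oo%E f <= kappa p' (adjoint_mx U) * pnorm p (gft u f),
      forall f : {ffun 'I_N -> X},
        [/\ pnorm +oo%E (gft u f) <= coherence U * pnorm 1%E f,
            pnorm +oo%E f <= coherence U * pnorm 1%E (gft u f),
            pnorm +oo%E (gft u f) <= pnorm 2%:E f
          & pnorm +oo%E f <= pnorm 2%:E (gft u f)],
      topological_isomorphism F
    & opnorm F = (kappa p' U)%:E].
Proof.
move=> U p' F.
have UU : adjoint_mx U *m U = 1%:M := adjoint_basis_mxM u_onb.
have UU' := mulmx1C UU.
have FE : F = mxact (adjoint_mx U) by apply/funext => f; exact: gftE.
have forward q (f : {ffun 'I_N -> X}) : (1 <= q)%E ->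
    pnorm +oo%E (gft u f) <= kappa (hoelder_conjugate q) U * pnorm q f.
  by move=> q1; rewrite gftE -[in leRHS](adjoint_mxK U); exact: pnorm_mxact_le.
have backward q (f : {ffun 'I_N -> X}) : (1 <= q)%E ->
    pnorm +oo%E f <=
    kappa (hoelder_conjugate q) (adjoint_mx U) * pnorm q (gft u f).
  move=> q1; rewrite -[f in leLHS]mxact1 -UU' -mxactM -gftE.
  exact: pnorm_mxact_le.
have le1M (c x : R) : c <= 1 -> 0 <= x -> c * x <= x by move=> c1 x0; exact: ler_piMl.
have e12 : (1 <= 2%:E :> \bar R)%E by rewrite lee_fin ler1n.
split=> [f|f||]; first by split; [exact: forward|exact: backward].
- split.
  + by have := forward 1%E f (lexx _); rewrite hoelder_conjugate1 kappay.
  + by have := backward 1%E f (lexx _);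
    rewrite hoelder_conjugate1 kappay coherence_adjoint.
  + apply: le_trans (forward 2%:E f e12) _.
    rewrite hoelder_conjugate2 le1M ?kappa2_unitary_le1//.
    by rewrite pnormE lnorm_ge0.
  + apply: le_trans (backward 2%:E f e12) _.
    rewrite hoelder_conjugate2 le1M ?kappa2_unitary_le1 ?adjoint_mxK//.
    by rewrite pnormE lnorm_ge0.
- by rewrite FE; exact: mxact_topological_isomorphism UU.
- by rewrite FE opnorm_mxact// adjoint_mxK.
Qed.
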